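(* Let $G$ be a simple graph of order $n \geq 2$ with maximum degree $\Delta$ and minimum degree $\delta$, and let $\alpha \in [0,1]$. Then $$\lambda_1(A_\alpha(G)) \geq \frac{\alpha(\Delta+\delta) + \sqrt{\alpha^2(\Delta-\delta)^2 + 4(1-\alpha)^2\Delta}}{2}.$$ If $G$ is connected, equality holds if and only if $G \cong K_{1,n-1}$.
   Context: For a simple graph $G$ with adjacency matrix $A(G)$ and diagonal degree matrix $D(G)$, and $\alpha\in[0,1]$, the $A_\alpha$-matrix is $A_\alpha(G)=\alpha D(G)+(1-\alpha)A(G)$. Its eigenvalues are listed in non-increasing order $\lambda_1(A_\alpha(G))\ge\dots\ge\lambda_n(A_\alpha(G))$. $K_{1,n-1}$ denotes the star on $n$ vertices.
   Formalization: The direction ''equality implies G ≅ K_{1,n-1}'' is stated only for α < 1, since at α = 1 equality holds for every graph (e.g. K_3, where both sides are 2); the inequality and ''star implies equality'' are stated for all α in [0,1]. *)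

(* Defs.v *)
From HB Require Import structures.
From mathcomp Require Import all_boot all_order all_algebra.
From mathcomp Require Import polyrcf.

Set Implicit Arguments.
Unset Strict Implicit.
Unset Printing Implicit Defensive.

Import Order.TTheory GRing.Theory Num.Theory.
Local Open Scope ring_scope.

Record sgraph := SGraph {
  vertex :> finType;
  edge : rel vertex;
  edge_sym : symmetric edge;
  edge_irrefl : irreflexive edge }.

Arguments edge {s}.

Definition degree (G : sgraph) (x : G) : nat := #|[set y | edge x y]|.

Definition max_degree (G : sgraph) : nat := (\max_(x : G) degree x)%N.

(* Every degree is less than #|G|, so for nonempty G the default value #|G|
   of the iterated minimum plays no role. *)
Definition min_degree (G : sgraph) : nat :=
  \big[minn/#|G|]_(x : G) degree x.

Definition connected_graph (G : sgraph) : Prop :=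
  forall x y : G, connect edge x y.

Definition isomorphic (G H : sgraph) : Prop :=
  exists2 f : G -> H, bijective f & forall x y, edge (f x) (f y) = edge x y.

Definition Kbip_edge (m n : nat) (x y : 'I_m + 'I_n) : bool :=
  match x, y with
  | inl _, inr _ | inr _, inl _ => true
  | _, _ => false
  end.

Lemma Kbip_sym m n : symmetric (@Kbip_edge m n).
Proof. by case=> x [] y. Qed.

Lemma Kbip_irrefl m n : irreflexive (@Kbip_edge m n).
Proof. by case. Qed.

Definition Kbip (m n : nat) : sgraph :=
  SGraph (@Kbip_sym m n) (@Kbip_irrefl m n).

Definition star (n : nat) : sgraph := Kbip 1 n.-1.

(* Rows and columns are indexed by the vertices in the order of enum G. *)
Definition adjacency_mx (R : pzSemiRingType) (G : sgraph) : 'M[R]_#|G| :=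
  \matrix_(i, j) (edge (enum_val i) (enum_val j))%:R.

Definition degree_mx (R : pzSemiRingType) (G : sgraph) : 'M[R]_#|G| :=
  diag_mx (\row_i (degree (enum_val i))%:R).

Definition Aalpha_mx (R : pzRingType) (alpha : R) (G : sgraph) : 'M[R]_#|G| :=
  alpha *: degree_mx R G + (1 - alpha) *: adjacency_mx R G.

(* The real eigenvalues of A, each repeated according to its multiplicity as a
   root of the characteristic polynomial, in non-increasing order.  When A is
   symmetric, the characteristic polynomial splits over R and the list has
   length n. *)
Definition eigenvalues (R : rcfType) (n : nat) (A : 'M[R]_n) : seq R :=
  let p := char_poly A in
  sort >=%R (flatten [seq nseq (mup x p) x | x <- rootsR p]).

(* Numbered from 1: lambda 1 A is the largest eigenvalue. *)
Definition lambda (R : rcfType) (k n : nat) (A : 'M[R]_n) : R :=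
  nth 0 (eigenvalues A) k.-1.

(* Main.v *)
Require Import Defs.
From mathcomp Require Import all_boot all_order all_algebra.
From mathcomp Require Import polyrcf complex spectral sesquilinear reals.
From mathcomp Require Import ring lra.

(** Let [v] be a vertex of maximum degree, [c] the bound, and let [f] be
    [c - alpha * delta] at [v], [1 - alpha] on the neighbours of [v] and [0]
    elsewhere.  As [c] is a root of
    [(x - alpha * Delta) * (x - alpha * delta) = (1 - alpha)^2 * Delta],
    one has [A_alpha f >= c f] pointwise, so the Rayleigh quotient of [f] is at
    least [c].  If [lambda_1 = c], then [f] maximises the Rayleigh quotient and
    is an eigenvector; by connectedness [f > 0], so every vertex is [v] or a
    neighbour of [v], and the equation at a neighbour of [v] leaves no room for
    an edge between two neighbours.  Conversely, on a star [f] is a positive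
    eigenvector for [c] when [alpha < 1], and a nonnegative matrix has no
    eigenvalue above that of a positive eigenvector.
    The Rayleigh principle comes from the spectral theorem over [R[i]]. *)

Set Implicit Arguments.
Unset Strict Implicit.
Unset Printing Implicit Defensive.

Import Order.TTheory GRing.Theory Num.Theory.
Local Open Scope ring_scope.

(** * Eigenvalues and the head of their sorted list *)

Lemma mem_eigenvalues (R : rcfType) (n : nat) (A : 'M[R]_n) (a : R) :
  (a \in eigenvalues A) = eigenvalue A a.
Proof.
rewrite /eigenvalues mem_sort eigenvalue_root_char.
have pN0 : char_poly A != 0 by exact: monic_neq0 (char_poly_monic A).
apply/flatten_mapP/idP => [[x xp]|rp].
  rewrite mem_nseq => /andP[_ /eqP ->].
  by move: xp; rewrite -roots_on_rootsR // => /andP[].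
exists a; first by rewrite -roots_on_rootsR // rp andbT in_itv.
(* A root has multiplicity at least 1, so its block in the list is nonempty. *)
by rewrite mem_nseq eqxx andbT -XsubC_dvd // dvdp_XsubCl.
Qed.

Lemma le_lambda1 (R : rcfType) (n : nat) (A : 'M[R]_n) (a : R) :
  eigenvalue A a -> a <= lambda 1 A.
Proof.
rewrite -mem_eigenvalues /lambda /=.
have : sorted >=%R (eigenvalues A) by apply: sort_sorted => x y; exact: le_total.
case: (eigenvalues A) => //= b s.
rewrite path_sortedE; last exact: ge_trans.
by case/andP=> /allP bs _; rewrite inE => /predU1P[->|/bs].
Qed.

(** The eigenvalue [a] witnesses that the list is nonempty, so its head is not the default value 0
    of [nth]. *)
Lemma lambda1_eigenvalue (R : rcfType) (n : nat) (A : 'M[R]_n) (a : R) :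
  eigenvalue A a -> eigenvalue A (lambda 1 A).
Proof.
rewrite -!mem_eigenvalues /lambda /=.
by case: (eigenvalues A) => //= b s _; rewrite inE eqxx.
Qed.

Lemma eigenvalue_le_of_subinvariant (R : rcfType) (n : nat) (A : 'M[R]_n)
    (w : 'cV[R]_n) (c a : R) :
    (forall i j, 0 <= A i j) -> (forall i, 0 < w i 0) ->
    (forall i, (A *m w) i 0 <= c * w i 0) ->
  eigenvalue A a -> a <= c.
Proof.
(* Pair [|v|] with [w]: [a * <|v|, w> <= <|v|, A w> <= c * <|v|, w>]. *)
move=> A0 w0 Aw /eigenvalueP[v vA vN0].
pose s := \sum_j `|v 0 j| * w j 0.
have s0 : 0 < s.
  have [j vj] : exists j, v 0 j != 0.
    apply/existsP; apply: contraNT vN0 => /existsPn v0.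
    by apply/eqP/rowP => j; rewrite mxE; apply/eqP; move: (v0 j); rewrite negbK.
  rewrite /s (bigD1 j) //= ltr_pwDl ?mulr_gt0 ?normr_gt0 //.
  by apply: sumr_ge0 => i _; rewrite mulr_ge0 // ltW.
suff : a * s <= c * s by rewrite ler_pM2r.
rewrite /s !mulr_sumr.
apply: (@le_trans _ _ (\sum_j \sum_i `|v 0 i| * A i j * w j 0)).
  apply: ler_sum => j _; rewrite mulrA -mulr_suml ler_pM2r //.
  apply: (@le_trans _ _ `|a * v 0 j|).
    by rewrite normrM ler_wpM2r // ler_norm.
  have <- : (v *m A) 0 j = a * v 0 j by rewrite vA mxE.
  rewrite mxE (le_trans (ler_norm_sum _ _ _)) //.
  by apply: ler_sum => i _; rewrite normrM (ger0_norm (A0 i j)).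
rewrite exchange_big /=; apply: ler_sum => i _.
rewrite mulrCA; under eq_bigr do rewrite -mulrA.
by rewrite -mulr_sumr ler_wpM2l //; move: (Aw i); rewrite mxE.
Qed.

(** * Rayleigh principle for real symmetric matrices *)

Section Spectral.
Variables (R : rcfType) (n : nat) (A : 'M[R]_n).
Hypothesis Asym : A^T = A.
Local Open Scope complex_scope.
Local Open Scope sesquilinear_scope.

Local Notation toC := (map_mx (real_complex R)).
Local Notation P := (spectralmx (toC A)).
Local Notation d := (spectral_diag (toC A)).

Lemma toC_hermsym : toC A \is hermsymmx.
Proof.
apply: realsym_hermsym.
  apply/is_hermitianmxP; rewrite expr0 scale1r map_mx_id //.
  by apply/matrixP => i j; rewrite !mxE -{1}Asym mxE.
by apply/mxOverP => i j; rewrite mxE complex_real.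
Qed.

Lemma spectral_symmetricE : toC A = P^t* *m diag_mx d *m P.
Proof.
rewrite -(invmx_unitary (spectral_unitarymx _)).
exact/orthomx_spectralP/hermitian_normalmx/toC_hermsym.
Qed.

Lemma spectral_diag_toC j : (complex.Re (d 0 j))%:C = d 0 j.
Proof.
apply: RRe_real.
by have /mxOverP := hermitian_spectral_diag_real toC_hermsym; exact.
Qed.

(** Row [j] of [P] is a left eigenvector over [R[i]]. Its eigenvalue is real, and a real root of the
    characteristic polynomial over [R[i]] is already a root over [R]. *)
Lemma spectral_diag_eigenvalue j : eigenvalue A (complex.Re (d 0 j)).
Proof.
rewrite eigenvalue_root_char -(fmorph_root (real_complex R)) map_char_poly.
rewrite -eigenvalue_root_char /= spectral_diag_toC.
apply/eigenvalueP; exists (row j P).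
  rewrite -row_mul {2}spectral_symmetricE !mulmxA.
  have /unitarymxP -> := spectral_unitarymx (toC A).
  by rewrite mul1mx row_mul row_diag_mx -scalemxAl -rowE.
(* A row of the invertible matrix [P] is nonzero. *)
apply/eqP => rj0; have := spectral_unit (toC A).
rewrite -row_free_unit => /row_free_inj inj_mulP.
move: (inj_mulP 1%N (delta_mx 0 j) 0); rewrite mul0mx -rowE => /(_ rj0)/rowP/(_ j)/eqP.
by rewrite !mxE !eqxx oner_eq0.
Qed.

(** The coordinates of [x] in the orthonormal eigenbasis formed by the rows of [P]. *)
Let y (x : 'rV[R]_n) := toC x *m P^t*.

Lemma spectral_coordK x : y x *m P = toC x.
Proof. by rewrite /y mulmxKtV // spectral_unitarymx. Qed.

(** The quadratic form of [c - A] is diagonal in the eigenbasis. For [c = lambda 1 A] all terms are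
    nonnegative, which yields both the Rayleigh bound and its equality case. *)
Lemma rayleigh_gapE (x : 'rV[R]_n) (c : R) :
  (c * (x *m x^T) 0 0 - (x *m A *m x^T) 0 0)%:C =
  \sum_j (c - complex.Re (d 0 j))%:C * `|y x 0 j| ^+ 2.
Proof.
have -> : (c * (x *m x^T) 0 0 - (x *m A *m x^T) 0 0)%:C =
   (y x *m (c%:C%:M - diag_mx d) *m (y x)^t*) 0 0.
  have -> : c * (x *m x^T) 0 0 - (x *m A *m x^T) 0 0 =
     (x *m (c%:M - A) *m x^T) 0 0.
    by rewrite mulmxBr mulmxBl mul_mx_scalar -scalemxAl !mxE.
  have -> (B : 'M[R]_1) : (B 0 0)%:C = (toC B) 0 0 by rewrite mxE.
  rewrite !map_mxM map_mxB map_scalar_mx /= {1}spectral_symmetricE.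
  have -> : toC x^T = (toC x)^t*.
    by apply/matrixP => i j; rewrite !mxE conj_Creal // complex_real.
  rewrite -{1 2}(spectral_coordK x) trmx_mul map_mxM.
  congr (fun_of_matrix _ 0 0).
  have PP : P *m P^t* = 1%:M by apply/unitarymxP; exact: spectral_unitarymx.
  (* Once [toC x] is written as [y x *m P], only the conjugate of [c - A] by [P] is left to
     compute. *)
  suff <- : P *m (c%:C%:M - P^t* *m diag_mx d *m P) *m P^t* = c%:C%:M - diag_mx d.
    by rewrite !mulmxA.
  rewrite mulmxBr mulmxBl !mulmxA PP mul1mx -[_ *m P *m P^t*]mulmxA PP mulmx1.
  by rewrite mul_mx_scalar -scalemxAl PP scalemx1.
rewrite -diag_const_mx -raddfB /= mxE.
apply: eq_bigr => j _.
rewrite mul_mx_diag !mxE rmorphB /= spectral_diag_toC normCK.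
by rewrite mulrAC mulrC mulrA.
Qed.

Lemma rayleigh_gap_term_ge0 (x : 'rV[R]_n) j :
  0 <= (lambda 1 A - complex.Re (d 0 j))%:C * `|y x 0 j| ^+ 2.
Proof.
rewrite mulr_ge0 ?exprn_ge0 // ler0c subr_ge0 le_lambda1 //.
exact: spectral_diag_eigenvalue.
Qed.

Lemma rayleigh_le_lambda1 (x : 'rV[R]_n) :
  (x *m A *m x^T) 0 0 <= lambda 1 A * (x *m x^T) 0 0.
Proof.
rewrite -subr_ge0 -ler0c rayleigh_gapE.
by apply: sumr_ge0 => j _; exact: rayleigh_gap_term_ge0.
Qed.

(** The gap is a vanishing sum of nonnegative terms, so [x] has nonzero coordinates only along
    eigenvectors for [lambda 1 A]. *)
Lemma rayleigh_eq_lambda1 (x : 'rV[R]_n) :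
  (x *m A *m x^T) 0 0 = lambda 1 A * (x *m x^T) 0 0 -> x *m A = lambda 1 A *: x.
Proof.
move=> eqx; have := rayleigh_gapE x (lambda 1 A).
rewrite eqx subrr => /esym/eqP.
rewrite psumr_eq0 => [/allP t0|j _]; last exact: rayleigh_gap_term_ge0.
have yd : y x *m diag_mx d = (lambda 1 A)%:C *: y x.
  apply/rowP => j; rewrite mul_mx_diag [LHS]mxE [RHS]mxE.
  have /= := t0 j (mem_index_enum j); rewrite mulf_eq0 sqrf_eq0 normr_eq0.
  case/orP => [|/eqP ->]; last by rewrite mul0r mulr0.
  rewrite rmorphB /= spectral_diag_toC subr_eq0 => /eqP ->.
  by rewrite mulrC.
apply: (@map_mx_inj _ _ (real_complex R)).
rewrite map_mxM map_mxZ {1}spectral_symmetricE !mulmxA.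
by rewrite -[toC x *m _]/(y x) yd -scalemxAl spectral_coordK.
Qed.

Lemma eigenvalue_lambda1 : (0 < n)%N -> eigenvalue A (lambda 1 A).
Proof.
move=> n0.
exact: lambda1_eigenvalue (spectral_diag_eigenvalue (Ordinal n0)).
Qed.

End Spectral.

(** * Degrees, and the matrix acting on functions of the vertices *)

Lemma degree_le_max (G : sgraph) (x : G) : (degree x <= max_degree G)%N.
Proof. exact: leq_bigmax. Qed.

Lemma min_le_degree (G : sgraph) (x : G) : (min_degree G <= degree x)%N.
Proof.
rewrite /min_degree; elim: (index_enum _) (mem_index_enum x) => // y s IHs.
by rewrite inE big_cons geq_min => /predU1P[<-|/IHs ->]; rewrite ?leqnn ?orbT.
Qed.

Lemma max_degree_attained (G : sgraph) :
  (0 < #|G|)%N -> exists v : G, degree v = max_degree G.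
Proof. by move=> /(@bigop.eq_bigmax _ (@degree G))[v vE]; exists v. Qed.

Definition vertex_row (R : pzRingType) (G : sgraph) (f : G -> R) : 'rV[R]_#|G| :=
  \row_i f (enum_val i).

(** The product of [Aalpha_mx] with [f], written vertex by vertex so that later arguments avoid
    matrix indices. *)
Definition Aalpha_act (R : pzRingType) (alpha : R) (G : sgraph) (f : G -> R)
    (u : G) : R :=
  alpha * (degree u)%:R * f u + (1 - alpha) * \sum_(w | edge u w) f w.

Lemma sum_enum_val (R : nmodType) (G : sgraph) (F : G -> R) :
  \sum_(i < #|G|) F (enum_val i) = \sum_u F u.
Proof. by rewrite [RHS](reindex _ (onW_bij _ (@enum_val_bij G))). Qed.

Lemma Aalpha_sym (R : pzRingType) (alpha : R) (G : sgraph) :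
  (Aalpha_mx alpha G)^T = Aalpha_mx alpha G.
Proof.
apply/matrixP => i j; rewrite !mxE edge_sym eq_sym.
by have [->|] := eqVneq i j; rewrite ?mulr0n.
Qed.

Lemma Aalpha_ge0 (R : numDomainType) (alpha : R) (G : sgraph) i j :
  0 <= alpha <= 1 -> 0 <= Aalpha_mx alpha G i j.
Proof.
case/andP=> a0 a1; rewrite !mxE addr_ge0 // mulr_ge0 ?subr_ge0 ?ler0n //.
by rewrite mulrn_wge0.
Qed.

Lemma vertex_row_mul_Aalpha (R : comPzRingType) (alpha : R) (G : sgraph)
    (f : G -> R) :
  vertex_row f *m Aalpha_mx alpha G = vertex_row (Aalpha_act alpha f).
Proof.
rewrite /Aalpha_mx mulmxDr -!scalemxAr; apply/rowP => j.
rewrite mxE [in LHS]mxE [(_ *: (_ *m adjacency_mx R G)) _ _]mxE.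
rewrite mul_mx_diag !mxE /Aalpha_act; congr (_ + _ * _).
  by rewrite mulrAC mulrA.
rewrite [RHS]big_mkcond -sum_enum_val; apply: eq_bigr => i _.
by rewrite !mxE edge_sym; case: ifP => _; rewrite ?mulr1 ?mulr0.
Qed.

Lemma vertex_row_dot (R : comPzRingType) (G : sgraph) (f g : G -> R) :
  (vertex_row f *m (vertex_row g)^T) 0 0 = \sum_u f u * g u.
Proof.
by rewrite mxE -sum_enum_val; apply: eq_bigr => i _; rewrite !mxE.
Qed.

Lemma Aalpha_rayleigh_le (R : rcfType) (alpha : R) (G : sgraph) (f : G -> R) :
  \sum_u Aalpha_act alpha f u * f u
    <= lambda 1 (Aalpha_mx alpha G) * \sum_u f u * f u.
Proof.
rewrite -!vertex_row_dot -vertex_row_mul_Aalpha.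
exact/rayleigh_le_lambda1/Aalpha_sym.
Qed.

Lemma Aalpha_rayleigh_eq (R : rcfType) (alpha : R) (G : sgraph) (f : G -> R) :
    \sum_u Aalpha_act alpha f u * f u
      = lambda 1 (Aalpha_mx alpha G) * \sum_u f u * f u ->
  forall u, Aalpha_act alpha f u = lambda 1 (Aalpha_mx alpha G) * f u.
Proof.
rewrite -!vertex_row_dot -vertex_row_mul_Aalpha => eqf u.
have /rowP/(_ (enum_rank u)) := rayleigh_eq_lambda1 (Aalpha_sym alpha G) eqf.
by rewrite vertex_row_mul_Aalpha !mxE enum_rankK.
Qed.

(** * Bounds on the largest eigenvalue from sub- and supersolutions *)

Section Subsolution.
Variables (R : rcfType) (alpha : R) (G : sgraph) (f : G -> R) (c : R).
Hypothesis f_ge0 : forall u, 0 <= f u.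
Hypothesis act_ge : forall u, c * f u <= Aalpha_act alpha f u.

Lemma sum_sqr_le_rayleigh :
  c * \sum_u f u * f u <= \sum_u Aalpha_act alpha f u * f u.
Proof.
rewrite mulr_sumr; apply: ler_sum => u _.
by rewrite mulrA ler_wpM2r.
Qed.

(** Pairing with [f] gives [c * <f, f> <= <A f, f> <= lambda_1 * <f, f>], and [f v > 0] makes
    [<f, f>] positive. *)
Lemma le_lambda1_of_subsolution v : 0 < f v -> c <= lambda 1 (Aalpha_mx alpha G).
Proof.
move=> fv; have s0 : 0 < \sum_u f u * f u.
  rewrite (bigD1 v) //= ltr_pwDl ?mulr_gt0 //.
  by apply: sumr_ge0 => u _; rewrite mulr_ge0.
rewrite -(ler_pM2r s0).
exact: le_trans sum_sqr_le_rayleigh (Aalpha_rayleigh_le _ _).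
Qed.

(** The same chain collapses to equalities, so [f] attains the Rayleigh maximum. *)
Lemma subsolution_eq : lambda 1 (Aalpha_mx alpha G) = c ->
  forall u, Aalpha_act alpha f u = c * f u.
Proof.
move=> lc u; rewrite -lc; apply: Aalpha_rayleigh_eq.
by apply/le_anti; rewrite Aalpha_rayleigh_le lc sum_sqr_le_rayleigh.
Qed.

End Subsolution.

Lemma lambda1_le_of_supersolution (R : rcfType) (alpha : R) (G : sgraph)
    (f : G -> R) (c : R) :
    (0 < #|G|)%N -> 0 <= alpha <= 1 -> (forall u, 0 < f u) ->
    (forall u, Aalpha_act alpha f u <= c * f u) ->
  lambda 1 (Aalpha_mx alpha G) <= c.
Proof.
move=> G0 ha f0 act_le.
apply: (@eigenvalue_le_of_subinvariant _ _ (Aalpha_mx alpha G) (vertex_row f)^T).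
- by move=> i j; exact: Aalpha_ge0.
- by move=> i; rewrite !mxE.
- move=> i; rewrite -{1}Aalpha_sym -trmx_mul vertex_row_mul_Aalpha.
  by rewrite [leLHS]mxE [leLHS]mxE [in leRHS]mxE [in leRHS]mxE.
- by apply: eigenvalue_lambda1 => //; exact: Aalpha_sym.
Qed.

(** * Stars and their degrees *)

(** The exclusive or says at once that [v] is adjacent to all other vertices and that these are
    pairwise nonadjacent. *)
Definition star_center (G : sgraph) (v : G) : Prop :=
  forall x y : G, edge x y = (x == v) (+) (y == v).

Lemma isomorphic_star (G : sgraph) (n : nat) (v : G) :
  #|G| = n -> (2 <= n)%N -> star_center v -> isomorphic G (star n).
Proof.
case: n => [|[|n]] // cardG _ vE.
pose s := enum (predC1 v).
have size_s : size s = n.+1 by rewrite -cardE cardC1 cardG.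
(* The centre goes to the single vertex of ['I_1]; the others are numbered by their position in
   [s]. *)
pose f (x : G) : 'I_1 + 'I_n.+1 :=
  if x == v then inl ord0 else inr (inord (index x s)).
have s_mem x : x != v -> (index x s < n.+1)%N.
  by rewrite -size_s index_mem mem_enum.
have f_inj : injective f.
  move=> x y; rewrite /f.
  have [->|xv] := eqVneq x v; have [->|yv] := eqVneq y v => // -[/(congr1 val)].
  rewrite /= !inordK ?s_mem // => eq_xy.
  by rewrite -[x](@nth_index _ v _ s) ?mem_enum // eq_xy nth_index ?mem_enum.
exists f; first by apply: inj_card_bij f_inj _; rewrite card_sum !card_ord cardG.
move=> x y; rewrite vE /= /f.
by case: (x == v); case: (y == v).
Qed.

Lemma star_center_of_isomorphic (G : sgraph) (n : nat) :
  isomorphic G (star n) -> exists v : G, star_center v.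
Proof.
case=> f [g fK gK] fE; exists (g (inl ord0)) => x y; rewrite -fE.
have eqg z : (z == g (inl ord0)) = (f z == inl ord0) by rewrite -(can_eq fK) gK.
by rewrite !eqg; case: (f x) => [i|i]; case: (f y) => [j|j] //=; rewrite ?ord1 ?eqxx.
Qed.

Section StarDegrees.
Variables (G : sgraph) (v : G).
Hypothesis vE : star_center v.

Lemma star_center_degree : degree v = #|G|.-1.
Proof.
rewrite -(cardC1 v) /degree; apply: eq_card => y.
by rewrite !inE vE eqxx; case: eqP.
Qed.

Lemma star_leaf_edge u w : u != v -> edge u w = (w == v).
Proof. by move=> /negbTE uv; rewrite vE uv. Qed.

Lemma star_leaf_degree u : u != v -> degree u = 1%N.
Proof.
move=> uv; rewrite -(cards1 v) /degree; apply: eq_card => y.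
by rewrite !inE star_leaf_edge.
Qed.

Lemma star_max_degree : (2 <= #|G|)%N -> max_degree G = #|G|.-1.
Proof.
move=> G2; apply/eqP; rewrite eqn_leq -{2}star_center_degree degree_le_max andbT.
apply/bigmax_leqP => u _; have [->|uv] := eqVneq u v.
  by rewrite star_center_degree.
by rewrite star_leaf_degree //; case: #|G| G2 => [|[]].
Qed.

Lemma star_min_degree : (2 <= #|G|)%N -> min_degree G = 1%N.
Proof.
move=> G2; apply/eqP; rewrite eqn_leq; apply/andP; split.
  have /card_gt0P[u] : (0 < #|predC1 v|)%N by rewrite cardC1; case: #|G| G2 => [|[]].
  by rewrite inE => uv; rewrite -(star_leaf_degree uv) min_le_degree.
(* The lower bound 1 must also hold for the default value [#|G|] of the minimum. *)
rewrite /min_degree; elim/big_ind: _ => [|x y|u _]; first exact: ltnW.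
  by rewrite leq_min => -> ->.
have [->|uv] := eqVneq u v; last by rewrite star_leaf_degree.
by rewrite star_center_degree; case: #|G| G2 => [|[]].
Qed.

End StarDegrees.

(** * The bound as a root of a quadratic *)

(** The larger eigenvalue of the two-by-two matrix with rows [(alpha * D, (1 - alpha) * D)] and
    [(1 - alpha, alpha * d)]. *)
Definition star_root (R : rcfType) (alpha D d : R) : R :=
  (alpha * (D + d)
   + Num.sqrt (alpha ^+ 2 * (D - d) ^+ 2 + 4 * (1 - alpha) ^+ 2 * D)) / 2.

Lemma star_rootE (R : rcfType) (alpha D d : R) : 0 <= D ->
  (star_root alpha D d - alpha * D) * (star_root alpha D d - alpha * d)
    = (1 - alpha) ^+ 2 * D.
Proof.
move=> D0; rewrite /star_root; set s := Num.sqrt _.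
have s2 : s ^+ 2 = alpha ^+ 2 * (D - d) ^+ 2 + 4 * (1 - alpha) ^+ 2 * D.
  rewrite sqr_sqrtr //; apply: addr_ge0.
    by apply: mulr_ge0; exact: sqr_ge0.
  by do 2!apply: mulr_ge0 => //; exact: sqr_ge0.
have -> : (1 - alpha) ^+ 2 * D = (s ^+ 2 - alpha ^+ 2 * (D - d) ^+ 2) / 4.
  by rewrite s2; field.
by field.
Qed.

(** Twice the difference is [alpha * (D - d)] plus a positive square root. This makes the test
    vector positive at its centre. *)
Lemma star_root_gt (R : rcfType) (alpha D d : R) :
  0 <= alpha < 1 -> 0 < D -> d <= D -> alpha * d < star_root alpha D d.
Proof.
move=> /andP[a0 a1] D0 dD; rewrite /star_root.
set s := Num.sqrt _; have s0 : 0 < s.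
  rewrite sqrtr_gt0; apply: ltr_wpDl.
    by apply: mulr_ge0; exact: sqr_ge0.
  apply: mulr_gt0 => //; apply: mulr_gt0 => //.
  by rewrite exprn_gt0 // subr_gt0.
have : 0 <= alpha * (D - d) by rewrite mulr_ge0 // subr_ge0.
by rewrite ltr_pdivlMr // mulrBr mulrDr => h; lra.
Qed.

Lemma star_root1 (R : rcfType) (D d : R) : d <= D -> star_root 1 D d = D.
Proof.
move=> dD; rewrite /star_root subrr expr0n /= mulr0 mul0r addr0 expr1n !mul1r.
by rewrite sqrtr_sqr ger0_norm ?subr_ge0 //; field.
Qed.

Lemma star_root0 (R : rcfType) (alpha : R) : star_root alpha 0 0 = 0.
Proof. by rewrite /star_root addr0 subrr expr0n /= !mulr0 !addr0 sqrtr0 addr0 mul0r. Qed.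

(** * The test vector around a vertex of maximum degree, for [alpha < 1] *)

Section StarVector.
Variables (R : rcfType) (alpha : R) (G : sgraph) (v : G).
Hypothesis ha : 0 <= alpha < 1.
Hypothesis vmax : degree v = max_degree G.
Hypothesis max_gt0 : (0 < max_degree G)%N.

Let D : R := (max_degree G)%:R.
Let d : R := (min_degree G)%:R.
Let c := star_root alpha D d.
Let b := 1 - alpha.
Let a := c - alpha * d.

(** The pair [(a, b)] is an eigenvector for [c] of the two-by-two matrix behind [star_root]. *)
Definition star_vector (u : G) : R :=
  if u == v then a else if edge v u then b else 0.

Let b_gt0 : 0 < b.
Proof. by rewrite subr_gt0; case/andP: ha. Qed.

Let a_gt0 : 0 < a.
Proof.
rewrite subr_gt0 star_root_gt ?ltr0n // ler_nat -vmax; exact: min_le_degree.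
Qed.

Lemma star_vector_ge0 u : 0 <= star_vector u.
Proof. by rewrite /star_vector; case: ifP => _; [|case: ifP => _] => //; exact: ltW. Qed.

Lemma star_vector_center : star_vector v = a.
Proof. by rewrite /star_vector eqxx. Qed.

Lemma star_vector_neighbor u : edge v u -> star_vector u = b.
Proof.
by move=> vu; rewrite /star_vector vu; case: eqP vu => // ->; rewrite edge_irrefl.
Qed.

Lemma star_vector_act_center : Aalpha_act alpha star_vector v = c * star_vector v.
Proof.
rewrite /Aalpha_act (eq_bigr (fun=> b)) => [|w]; last exact: star_vector_neighbor.
rewrite sumr_const star_vector_center.
have -> : #|[pred w | edge v w]| = max_degree G.
  by rewrite -vmax /degree; apply: eq_card => w; rewrite !inE.
(* At [v] the eigenvalue equation is exactly the quadratic equation of [c]. *)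
have /(_ (ler0n _ _)) := @star_rootE R alpha D d.
rewrite vmax -/c -/D -[b *+ _]mulr_natr -/D /a /b => h.
by rewrite [X in _ + X]mulrA -expr2 -h; ring.
Qed.

(** Since [alpha * d * b + (1 - alpha) * a = c * b], what exceeds [c * star_vector u] is a degree
    term and the contribution of the neighbours other than [v]. Both are nonnegative, and both
    vanish at the leaves of a star. *)
Lemma star_vector_act_neighbor u : edge v u ->
  Aalpha_act alpha star_vector u =
  c * star_vector u + alpha * ((degree u)%:R - d) * b
  + (1 - alpha) * \sum_(w | edge u w && (w != v)) star_vector w.
Proof.
move=> vu; rewrite /Aalpha_act (bigD1 v) /=; last by rewrite edge_sym.
rewrite star_vector_center star_vector_neighbor // /a /b; ring.
Qed.

Lemma star_vector_subsolution u :
  c * star_vector u <= Aalpha_act alpha star_vector u.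
Proof.
have [a0 _] := andP ha.
have sum_ge0 (P : pred G) : 0 <= \sum_(w | P w) star_vector w.
  by apply: sumr_ge0 => w _; exact: star_vector_ge0.
have [->|uv] := eqVneq u v; first by rewrite star_vector_act_center.
have [vu|/negbTE vu] := boolP (edge v u).
  rewrite star_vector_act_neighbor // -addrA lerDl addr_ge0 ?mulr_ge0 ?(ltW b_gt0) //.
  by rewrite subr_ge0 ler_nat min_le_degree.
(* Off the closed neighbourhood of [v] the vector is 0, and the action is nonnegative. *)
rewrite {1}/star_vector (negbTE uv) vu mulr0 addr_ge0 ?mulr_ge0 //.
- exact: star_vector_ge0.
- exact: ltW b_gt0.
Qed.

Lemma star_root_le_lambda1 : c <= lambda 1 (Aalpha_mx alpha G).
Proof.
have := le_lambda1_of_subsolution star_vector_ge0 star_vector_subsolution (v := v).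
apply.
by rewrite star_vector_center.
Qed.

Hypothesis Gconn : connected_graph G.
Hypothesis lambda1_eq : lambda 1 (Aalpha_mx alpha G) = c.

Let act_eq := subsolution_eq star_vector_ge0 star_vector_subsolution lambda1_eq.

(** The hypothesis is only [<= 0] so that it also applies after a nonnegative term has been dropped
    from a sum equal to 0. *)
Let sum_eq0 (P : pred G) w :
  (1 - alpha) * (\sum_(w | P w) star_vector w) <= 0 -> P w -> star_vector w = 0.
Proof.
rewrite pmulr_rle0 // => s_le0 Pw.
have : \sum_(w | P w) star_vector w = 0.
  by apply/le_anti; rewrite s_le0 sumr_ge0 // => x _; exact: star_vector_ge0.
move/eqP; rewrite psumr_eq0 => [/allP/(_ w (mem_index_enum w))|x _].
  by rewrite Pw => /eqP.
exact: star_vector_ge0.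
Qed.

(** A zero at [y] would, by the eigenvalue equation at [y], force zeros at all its neighbours; hence
    positivity spreads from [v] along paths. *)
Lemma extremal_star_vector_gt0 u : 0 < star_vector u.
Proof.
have step x y : edge x y -> 0 < star_vector x -> 0 < star_vector y.
  move=> xy fx; rewrite lt_def star_vector_ge0 andbT; apply/eqP => fy0.
  have := act_eq y; rewrite /Aalpha_act fy0 !mulr0 add0r => s0.
  have /= := @sum_eq0 (edge y) x; rewrite s0 lexx edge_sym => /(_ isT xy) fx0.
  by rewrite fx0 ltxx in fx.
have /connectP[p] := Gconn v u.
have : 0 < star_vector v by rewrite star_vector_center.
elim: p v => [|y p IHp] x fx /=; first by move=> _ ->.
by case/andP=> /step/(_ fx)/IHp.
Qed.

Lemma extremal_star_center : star_center v.
Proof.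
have vE u : u != v -> edge v u.
  move=> uv; have := extremal_star_vector_gt0 u.
  by rewrite /star_vector (negbTE uv); case: ifP => //; rewrite ltxx.
have no_edge x y : x != v -> y != v -> edge x y = false.
  move=> xv yv; apply/negP => xy.
  have := act_eq x; rewrite star_vector_act_neighbor ?vE // -addrA => /eqP.
  (* The eigenvalue equation at [x] says that the excess over [c * star_vector x] is 0. *)
  rewrite -subr_eq0 [c * _ + _]addrC addrK => /eqP s0.
  have s_le0 : (1 - alpha) * (\sum_(w | edge x w && (w != v)) star_vector w) <= 0.
    rewrite -[leRHS]s0 lerDr !mulr_ge0 ?(ltW b_gt0) //; first by case/andP: ha.
    by rewrite subr_ge0 ler_nat min_le_degree.
  have := sum_eq0 (w := y) s_le0; rewrite xy yv => /(_ isT) fy0.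
  by have := extremal_star_vector_gt0 y; rewrite fy0 ltxx.
move=> x y; have [->|xv] := eqVneq x v; have [->|yv] := eqVneq y v => /=.
- exact: edge_irrefl.
- exact: vE.
- by rewrite edge_sym vE.
- exact: no_edge.
Qed.

End StarVector.

(** * The remaining cases and the equality characterisation *)

Lemma max_degree_le_lambda1 (R : rcfType) (alpha : R) (G : sgraph) :
  (0 < #|G|)%N -> 0 <= alpha <= 1 ->
  alpha * (max_degree G)%:R <= lambda 1 (Aalpha_mx alpha G).
Proof.
move=> /max_degree_attained[v vmax] /andP[_ a1].
have f0 u : 0 <= (u == v)%:R :> R by rewrite ler0n.
have act_ge u : alpha * (max_degree G)%:R * (u == v)%:R
    <= Aalpha_act alpha (fun u => (u == v)%:R) u.
  have s0 : 0 <= (1 - alpha) * \sum_(w | edge u w) (w == v)%:R.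
    by rewrite mulr_ge0 ?subr_ge0 // sumr_ge0 // => w _; rewrite ler0n.
  rewrite /Aalpha_act; move: s0.
  have [->|_] := eqVneq u v; rewrite /= ?mulr1n ?mulr0n ?mulr0 ?add0r //.
  by rewrite vmax !mulr1 lerDl.
by apply: (le_lambda1_of_subsolution f0 act_ge (v := v)); rewrite eqxx ltr01.
Qed.

Lemma star_lambda1_le (R : rcfType) (alpha : R) (G : sgraph) (v : G) :
    (2 <= #|G|)%N -> 0 <= alpha <= 1 -> star_center v ->
  lambda 1 (Aalpha_mx alpha G)
    <= star_root alpha (max_degree G)%:R (min_degree G)%:R.
Proof.
move=> G2 ha vE; have G0 : (0 < #|G|)%N by exact: ltnW.
have vmax : degree v = max_degree G.
  by rewrite (star_max_degree vE) // (star_center_degree vE).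
have d_le_D : (min_degree G)%:R <= (max_degree G)%:R :> R.
  by rewrite ler_nat -vmax min_le_degree.
case/andP: (ha) => a0; rewrite le_eqVlt => /predU1P[a1|a1].
  rewrite a1 star_root1 //.
  (* At [alpha = 1] the star vector vanishes on the leaves; the matrix is the degree matrix, and the
     constant 1 is a positive supersolution. *)
  apply: (@lambda1_le_of_supersolution _ _ _ (fun=> 1)) => //.
    by rewrite ler01 lexx.
  move=> u; rewrite /Aalpha_act subrr mul0r addr0 mul1r !mulr1.
  by rewrite ler_nat degree_le_max.
have ha1 : 0 <= alpha < 1 by rewrite a0.
have max_gt0 : (0 < max_degree G)%N.
  by rewrite (star_max_degree vE) //; case: #|G| G2 => [|[]].
have v_adj u : u != v -> edge v u by move=> uv; rewrite vE eqxx (negbTE uv).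
apply: (@lambda1_le_of_supersolution _ _ _ (star_vector alpha v)) => // u.
  have [->|uv] := eqVneq u v; last by rewrite star_vector_neighbor ?v_adj // subr_gt0.
  by rewrite star_vector_center subr_gt0 star_root_gt // ltr0n.
have [->|uv] := eqVneq u v; first by rewrite star_vector_act_center.
rewrite star_vector_act_neighbor ?v_adj // (star_leaf_degree vE) //.
rewrite (star_min_degree vE) // subrr mulr0 mul0r addr0 big1 ?mulr0 ?addr0 //.
by move=> w /andP[]; rewrite (star_leaf_edge vE) // => ->.
Qed.

Theorem theorem9 (R : realType) (n : nat) (G : sgraph) (alpha : R)
    (hG : #|G| = n) (hn : (2 <= n)%N) (ha : 0 <= alpha <= 1) :
  let Delta : R := (max_degree G)%:R in
  let delta : R := (min_degree G)%:R in
  let bound : R :=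
    (alpha * (Delta + delta)
     + Num.sqrt (alpha ^+ 2 * (Delta - delta) ^+ 2
                 + 4 * (1 - alpha) ^+ 2 * Delta)) / 2 in
  lambda 1 (Aalpha_mx alpha G) >= bound
  /\ (connected_graph G ->
        (isomorphic G (star n) -> lambda 1 (Aalpha_mx alpha G) = bound)
        /\ (alpha < 1 ->
            lambda 1 (Aalpha_mx alpha G) = bound -> isomorphic G (star n))).
Proof.
move=> Delta delta bound.
have G2 : (2 <= #|G|)%N by rewrite hG.
have G0 : (0 < #|G|)%N by exact: ltnW.
have [v vmax] := max_degree_attained G0.
have d_le_D : (min_degree G <= max_degree G)%N by rewrite -vmax min_le_degree.
have bound_le : bound <= lambda 1 (Aalpha_mx alpha G).
  rewrite -[bound]/(star_root alpha Delta delta).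
  have := max_degree_le_lambda1 G0 ha.
  have [D0 _|D_gt0] := posnP (max_degree G).
    have -> : delta = 0 by apply/eqP; rewrite pnatr_eq0 -leqn0 -D0.
    rewrite /Delta D0 star_root0.
    by apply: le_trans (max_degree_le_lambda1 G0 ha); rewrite D0 mulr0.
  case/andP: ha => a0; rewrite le_eqVlt => /predU1P[->|a1 _].
    by rewrite mul1r star_root1 // ler_nat.
  by apply: (star_root_le_lambda1 (v := v)) => //; rewrite a0.
split=> // Gconn; split.
  case/star_center_of_isomorphic => w wE; apply/le_anti.
  by rewrite bound_le andbT; exact: star_lambda1_le wE.
(* Here [alpha < 1] is essential: at [alpha = 1] both sides equal the maximum degree for every
   graph. *)
move=> a1 eq_bound; apply: (isomorphic_star (v := v)) => //.
apply: (extremal_star_center (alpha := alpha)) => //.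
  by case/andP: ha => ->.
(* The maximum degree is positive: a path from [v] to another vertex starts with an edge at [v]. *)
have [w vw] : exists w, w != v.
  have /card_gt0P[w] : (0 < #|predC1 v|)%N by rewrite cardC1; case: #|G| G2 => [|[]].
  by exists w.
have /connectP[[|x p] /=] := Gconn v w; first by move=> _ wv; rewrite wv eqxx in vw.
case/andP=> vx _ _; rewrite -vmax /degree; apply/card_gt0P; exists x.
by rewrite inE.
Qed.
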